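(* For integers $n \ge 4$ let $B(n) = \prod_{i=1}^{\lfloor \log_2 n \rfloor} (2^i - 1)$. Then \[ B(n) = 2^{\frac{1}{2}(\log_2 n)^2 + O(\log n)} = n^{\frac{1}{2}\log_2 n + O(1)} . \] That is, there is a constant $C > 0$ such that for all integers $n \ge 4$, $\left| \log_2 B(n) - \tfrac{1}{2}(\log_2 n)^2 \right| \le C \log_2 n$. *)

(* Defs.v *)
From mathcomp Require Import all_boot all_order all_algebra.
From mathcomp Require Import reals exp.
Set Implicit Arguments.
Unset Strict Implicit.
Unset Printing Implicit Defensive.
Import Order.TTheory GRing.Theory Num.Theory.
Local Open Scope ring_scope.

Definition log2 (R : realType) (x : R) : R := ln x / ln 2.

(* [trunc_log 2 n] is the floor of the base-2 logarithm of [n]; see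
   [truncn_log2] below. The truncated subtraction is exact since 1 <= 2 ^ i. *)
Definition B (n : nat) : nat :=
  (\prod_(1 <= i < (trunc_log 2 n).+1) (2 ^ i - 1))%N.

Lemma truncn_log2 (R : realType) (n : nat) :
  (0 < n)%N -> Num.truncn (log2 (n%:R : R)) = trunc_log 2 n.
Proof.
move=> n0; apply: truncn_def.
have l2 : 0 < ln 2 :> R by rewrite ln_gt0 // ltr1n.
have nR : 0 < n%:R :> R by rewrite ltr0n.
have lnX k : k%:R * ln 2 = ln ((2 ^ k)%N%:R : R).
  by rewrite natrX lnXn ?ltr0n// mulr_natl.
have pX k : 0 < (2 ^ k)%N%:R :> R by rewrite ltr0n expn_gt0.
rewrite /log2 ler_pdivlMr// ltr_pdivrMr// !lnX ler_ln ?posrE// ltr_ln ?posrE//.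
by rewrite ler_nat ltr_nat trunc_logP//= trunc_log_ltn.
Qed.

(* Main.v *)
Require Import Defs.
From mathcomp Require Import all_boot all_order all_algebra.
From mathcomp Require Import ring lra zify.
From mathcomp Require Import reals exp.
Import Order.TTheory GRing.Theory Num.Theory.
Local Open Scope ring_scope.

(** Since [2 ^ (i - 1) <= 2 ^ i - 1 <= 2 ^ i], the product [B n] lies between
    [2 ^ (k (k - 1) / 2)] and [2 ^ (k (k + 1) / 2)], where [k] is the floor of
    [L = log2 n]. As [k <= L < k + 1], both exponents are within [3 / 2 * L] of
    [L ^ 2 / 2]. *)

Lemma expn2_bin_le_prod (k : nat) :
  (2 ^ 'C(k, 2) <= \prod_(1 <= i < k.+1) (2 ^ i - 1))%N.
Proof.
elim: k => [|k IHk]; first by rewrite big_nil.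
(* Pascal's rule adds [k] to the exponent, so the new factor only needs [2 ^ k <= 2 ^ k.+1 - 1],
   which is [1 <= 2 ^ k]. *)
rewrite big_nat_recr//= binS bin1 expnD leq_mul// expnS.
have := expn_gt0 2 k; lia.
Qed.

Lemma prod_le_expn2_bin (k : nat) :
  (\prod_(1 <= i < k.+1) (2 ^ i - 1) <= 2 ^ 'C(k.+1, 2))%N.
Proof.
elim: k => [|k IHk]; first by rewrite big_nil.
by rewrite big_nat_recr//= binS bin1 expnD leq_mul// leq_subr.
Qed.

Lemma B_gt0 (n : nat) : (0 < B n)%N.
Proof. by apply: leq_trans (expn2_bin_le_prod _); rewrite expn_gt0. Qed.

(** The subtraction is taken in [R]; at [k = 0] the factor [k] still makes the product vanish. *)
Lemma natr_bin2 (R : realType) (k : nat) :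
  'C(k, 2)%:R = 1 / 2 * (k%:R * (k%:R - 1)) :> R.
Proof.
elim: k => [|k IHk]; first by rewrite mul0r mulr0.
by rewrite binS bin1 natrD IHk -natr1; field.
Qed.

Section Log2.
Context {R : realType}.
Implicit Types (x y : R) (k m n : nat).

Lemma ln2_gt0 : 0 < ln 2 :> R.
Proof. by rewrite ln_gt0// ltr1n. Qed.

Lemma log2_expn k : log2 (2 ^ k)%N%:R = k%:R :> R.
Proof.
by rewrite /log2 natrX lnXn ?ltr0n// -[_ *+ k]mulr_natl mulfK// gt_eqF// ln2_gt0.
Qed.

Lemma ler_log2_nat m n : (0 < m)%N -> (m <= n)%N ->
  log2 m%:R <= log2 n%:R :> R.
Proof.
move=> m0 mn; rewrite /log2 ler_pM2r ?invr_gt0 ?ln2_gt0//.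
by rewrite ler_ln ?posrE ?ltr0n ?ler_nat// (leq_trans m0).
Qed.

Lemma log2_nat_gt0 n : (1 < n)%N -> 0 < log2 n%:R :> R.
Proof. by move=> n1; rewrite divr_gt0 ?ln2_gt0// ln_gt0// ltr1n. Qed.

Lemma powR2_log2 x : 0 < x -> 2 `^ log2 x = x.
Proof.
by move=> x0; rewrite /powR pnatr_eq0/= divfK ?lnK ?posrE// gt_eqF// ln2_gt0.
Qed.

Lemma log2_B_dist n : (1 < n)%N ->
  `|log2 (B n)%:R - 1 / 2 * log2 n%:R ^+ 2| <= 3 / 2 * log2 n%:R :> R.
Proof.
move=> n1; have L0 := ltW (log2_nat_gt0 n n1).
have := truncn_itv L0; rewrite truncn_log2 ?(ltnW n1)//.
have k1 : (1 <= trunc_log 2 n)%N by rewrite trunc_log_gt0.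
have := ler_log2_nat _ _ (B_gt0 n) (prod_le_expn2_bin _).
have := ler_log2_nat (2 ^ 'C(trunc_log 2 n, 2)) (B n) _ (expn2_bin_le_prod _).
rewrite expn_gt0 => /(_ isT); rewrite !log2_expn !natr_bin2 -[(trunc_log 2 n).+1%:R]natr1.
move: k1; rewrite -(ler_nat R).
move: L0; set k : R := (trunc_log 2 n)%:R.
set L := log2 n%:R; set S := log2 (B n)%:R => L0 k1 lo hi /andP[kL Lk].
(* Above, [k <= L] gives [S <= L * (L + 1) / 2]. Below, [k * (k - 1) - (L - 1) * (L - 2) = (k - L +
   1) * (k + L - 2)] is nonnegative because [L < k + 1] and [1 <= k <= L]; hence
   [S >= L ^ 2 / 2 - 3 / 2 * L + 1], the source of the constant [3 / 2]. *)
by rewrite ler_norml; apply/andP; split; nra.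
Qed.

End Log2.

Theorem mainTheorem4 (R : realType) :
  [/\ exists2 f : nat -> R,
        (exists2 C : R, 0 < C &
           forall n : nat, (4 <= n)%N -> `|f n| <= C * ln n%:R) &
        forall n : nat, (4 <= n)%N ->
          (B n)%:R = 2 `^ (1 / 2 * log2 n%:R ^+ 2 + f n),
      exists2 g : nat -> R,
        (exists2 C : R, 0 < C & forall n : nat, (4 <= n)%N -> `|g n| <= C) &
        forall n : nat, (4 <= n)%N ->
          (B n)%:R = n%:R `^ (1 / 2 * log2 n%:R + g n)
    & exists2 C : R, 0 < C &
        forall n : nat, (4 <= n)%N ->
          `|log2 (B n)%:R - 1 / 2 * log2 n%:R ^+ 2| <= C * log2 n%:R].
Proof.
(* With [f] the exact error in the exponent, the first formula is an identity, and all three claims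
   rest on the one bound [f_le]. *)
pose f n : R := log2 (B n)%:R - 1 / 2 * log2 n%:R ^+ 2.
have fE n : (B n)%:R = 2 `^ (1 / 2 * log2 n%:R ^+ 2 + f n).
  by rewrite addrC subrK powR2_log2// ltr0n B_gt0.
have f_le n : (4 <= n)%N -> `|f n| <= 3 / 2 * log2 n%:R.
  by move=> n4; apply: log2_B_dist; apply: leq_trans n4.
split.
(* Dividing by [ln 2] turns the bound in [log2 n] into one in [ln n]. *)
- exists f => //; exists (3 / 2 / ln 2) => [|n n4].
    by rewrite !divr_gt0 ?ln2_gt0.
  by rewrite mulrAC -(mulrA (3 / 2)); apply: f_le.
(* Changing base from 2 to [n = 2 ^ (log2 n)] divides the exponent by [log2 n], which is positive
   here, so the error becomes bounded. *)
- exists (fun n => f n / log2 n%:R) => [|n n4].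
    exists (3 / 2) => [|n n4]; first by rewrite divr_gt0.
    have L0 : 0 < log2 n%:R :> R by apply/log2_nat_gt0/leq_trans/n4.
    by rewrite normrM normfV (gtr0_norm L0) ler_pdivrMr// f_le.
  have L0 : 0 < log2 n%:R :> R by apply/log2_nat_gt0/leq_trans/n4.
  have -> y : n%:R `^ y = 2 `^ (log2 n%:R * y) :> R.
    by rewrite powRrM powR2_log2// ltr0n (leq_trans _ n4).
  by rewrite fE; congr (_ `^ _); field; rewrite gt_eqF.
- by exists (3 / 2) => //; rewrite divr_gt0.
Qed.
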